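(* Let $k$ be a field, let $n\ge 3$, and let $W_n$ be the wheel graph on $n+1$ vertices. Then for $i\ge 1$ the graded Betti numbers of the graph algebra $W_n$ are as follows. (i) If $j>i+1$, then $\beta_{i,j}(W_n)=\beta_{i,j}(C_n)+\beta_{i-1,j-1}(C_n)$. (ii) If $j=i+1$, then $\beta_{i,i+1}(W_n)=\beta_{i,i+1}(C_n)+\beta_{i-1,i}(C_n)+\binom{n}{i}$.
   Context: The same symbol is used for a graph and its graph algebra. Cycle graph algebra: $C_n=k[x_1,\ldots,x_n]/(x_1x_2,x_2x_3,\ldots,x_{n-1}x_n,x_nx_1)$. The wheel graph $W_n$ is the cycle $C_n$ with an extra vertex $x_0$ (the center) connected to all vertices of $C_n$; its algebra is $W_n=k[x_0,\ldots,x_n]/(x_1x_2,x_2x_3,\ldots,x_nx_1,x_0x_1,\ldots,x_0x_n)$. For a graded algebra $R=A/I$ with $A$ the displayed polynomial ring (standard grading; $A=k[x_1,\ldots,x_n]$ for $C_n$ and $A=k[x_0,\ldots,x_n]$ for $W_n$), the graded Betti numbers are $\beta_{i,j}(R)=\dim_k \mathrm{Tor}_i^A(R,k)_j$. *)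

(* Defs.v *)
From HB Require Import structures.
From mathcomp Require Import all_boot all_order all_algebra.
From mathcomp Require Import mpoly.

Set Implicit Arguments.
Unset Strict Implicit.
Unset Printing Implicit Defensive.

Import GRing.Theory.
Local Open Scope ring_scope.

Definition ideal_gen (R : comNzRingType) (s : seq R) : R -> Prop :=
  fun p => exists c : 'I_(size s) -> R, p = \sum_(a < size s) c a * s`_a.

(* The variable x_(i+1) of k[x_1, ..., x_n] is 'X_i for i : 'I_n, and ordS is
   the cyclic successor, so x_n x_1 is included. *)
Definition cycle_ideal (k : fieldType) (n : nat) : {mpoly k[n]} -> Prop :=
  ideal_gen [seq ('X_i * 'X_(ordS i) : {mpoly k[n]}) | i <- enum 'I_n].

(* In k[x_0, ..., x_n] the center x_0 is 'X_ord0, and the variable x_(i+1)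
   of the rim is 'X_(lift ord0 i) for i : 'I_n. *)
Definition wheel_ideal (k : fieldType) (n : nat) : {mpoly k[n.+1]} -> Prop :=
  ideal_gen
    ([seq ('X_(lift ord0 i) * 'X_(lift ord0 (ordS i)) : {mpoly k[n.+1]})
       | i <- enum 'I_n] ++
     [seq ('X_ord0 * 'X_(lift ord0 i) : {mpoly k[n.+1]}) | i <- enum 'I_n]).

(* A graded free resolution
     ... -> F_2 -> F_1 -> F_0 -> A/I -> 0,   A = k[x_1, ..., x_n],
   by finitely generated graded free modules F_i = \bigoplus_s A(- frdeg i s).
   Elements of F_i are row vectors and maps act by right multiplication.  The
   augmentation F_0 -> A/I is given by representatives in A of the images of
   the basis elements.  All maps are homogeneous of degree 0. *)
Record graded_free_resolution (k : fieldType) (n : nat)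
    (I : {mpoly k[n]} -> Prop) := GradedFreeResolution {
  frrank : nat -> nat;
  frdeg : forall i, 'I_(frrank i) -> nat;
  fraug : 'cV[{mpoly k[n]}]_(frrank 0);
  frdiff : forall i, 'M[{mpoly k[n]}]_(frrank i.+1, frrank i);
  fraug_homog : forall s m, m \in msupp (fraug s 0) -> mdeg m = frdeg s;
  frdiff_homog : forall i s t m, m \in msupp (frdiff i s t) ->
    (mdeg m + frdeg t)%N = frdeg s;
  fraug_surj : forall p : {mpoly k[n]},
    exists v : 'rV_(frrank 0), I ((v *m fraug) 0 0 - p);
  frexact0 : forall v : 'rV_(frrank 0),
    I ((v *m fraug) 0 0) <-> exists u, v = u *m frdiff 0;
  frexactS : forall i (v : 'rV_(frrank i.+1)),
    v *m frdiff i = 0 <-> exists u, v = u *m frdiff i.+1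
}.

Section Tor.
Variables (k : fieldType) (n : nat) (I : {mpoly k[n]} -> Prop).
Variable F : graded_free_resolution I.

(* With k = A/(x_1, ..., x_n), the module F_i \otimes_A k is k^(frrank F i),
   and its differential is obtained by taking constant terms of entries. *)
Definition tor_diff i : 'M[k]_(frrank F i.+1, frrank F i) :=
  map_mx (mcoeff 0%MM) (frdiff F i).

(* The row space of this matrix is (F_i \otimes_A k)_j. *)
Definition tor_part i j : 'M[k]_(frrank F i) :=
  diag_mx (\row_s (frdeg s == j)%:R).

Definition tor_cycles i j : 'M[k]_(frrank F i) :=
  match i return 'M[k]_(frrank F i) with
  | 0%N => tor_part 0 j
  | i'.+1 => (tor_part i'.+1 j :&: kermx (tor_diff i'))%MS
  end.

Definition tor_boundaries i j : 'M[k]_(frrank F i.+1, frrank F i) :=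
  tor_part i.+1 j *m tor_diff i.

(* dim_k Tor_i^A(A/I, k)_j, computed from the resolution F. *)
Definition betti i j : nat :=
  (\rank (tor_cycles i j) - \rank (tor_boundaries i j))%N.

Lemma tor_diff_part i j : tor_part i.+1 j *m tor_diff i = tor_diff i *m tor_part i j.
Proof.
apply/matrixP => s t; rewrite mul_diag_mx mul_mx_diag !mxE.
case: (altP ((frdiff F i s t)@_0%MM =P 0)) => [->|]; first by rewrite mulr0 mul0r.
rewrite -mcoeff_msupp => /frdiff_homog; rewrite mdeg0 add0n => ->.
by rewrite mulrC.
Qed.

Lemma tor_diff_diff i : tor_diff i.+1 *m tor_diff i = 0.
Proof.
rewrite -map_mxM; have -> : frdiff F i.+1 *m frdiff F i = 0.
  apply/row_matrixP => s; rewrite row_mul row0.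
  by apply/frexactS; exists (delta_mx 0 s); rewrite rowE.
by rewrite map_mx0.
Qed.

Lemma tor_boundaries_cycles i j : (tor_boundaries i j <= tor_cycles i j)%MS.
Proof.
rewrite /tor_boundaries; case: i => [|i] /=.
  by rewrite tor_diff_part submxMl.
rewrite sub_capmx {1}tor_diff_part submxMl /=.
by apply/sub_kermxP; rewrite -mulmxA tor_diff_diff mulmx0.
Qed.

End Tor.

(* Main.v *)
Require Import Defs.
From HB Require Import structures.
From mathcomp Require Import all_boot all_order all_algebra.
From mathcomp Require Import mpoly zify.
From Stdlib Require Import ClassicalEpsilon.

(** Write A' = k[x_1, ..., x_n], A = A'[x_0], C = A'/I for the cycle algebra and
    m for the ideal of A' generated by its variables.  The wheel ideal consists of
    the polynomials whose coefficient of x_0^0 lies in I and whose coefficients of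
    x_0, x_0^2, ... lie in m ([wheel_idealE]).  Equivalently, there is an exact
    sequence
      0 -> C[x_0](-1) -> C[x_0] (+) k[x_0](-1) -> W -> 0
    with maps f |-> (x_0 f, f mod m) and (a, c) |-> a - x_0 c.

    Let F resolve C and let K be the Koszul resolution of k = A'/m over A'.  If
    psi : F -> K lifts C -> k, then the mapping cone of (x_0, psi), with terms
    F_i (+) K_i(-1) (+) F_(i-1)(-1), resolves W ([cone]).  After tensoring with k
    the map x_0 vanishes, and so does psi_i for i > 0 if psi is well chosen
    ([linear_comparison]); psi_0 only matters in internal degrees too low to
    interfere.  Hence for j > i >= 1
      Tor_i(W)_j = Tor_i(C)_j (+) Tor_(i-1)(C)_(j-1) (+) Tor_i(k)_(j-1),
    and the last summand has dimension 'C(n, i) if j = i + 1 and 0 otherwise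
    ([betti_cone]).

    Three ingredients support this computation.
    - Betti numbers may be computed from any resolution ([betti_invariant]):
      comparison maps exist in both directions and their composite is homotopic
      to the identity.
    - The entries of psi_i must have no constant term although F need not be
      minimal.  As K_i is generated in degree i, only basis elements of F_i of
      degree exactly i are in question.  If psi_i is obtained by lifting
      psi_(i-1) d along K in a k-linear way, then these are sent to 0 by
      induction on i, starting from the fact that I contains no linear form.
      Lifting k-linearly is the purpose of [homog_lift].
    - The Koszul resolution is itself an iterated cone: adjoining x_0 to the
      irrelevant ideal is the case where K resolves the zero module ([koszul]). *)

Set Implicit Arguments.
Unset Strict Implicit.
Unset Printing Implicit Defensive.

Import GRing.Theory.
Local Open Scope ring_scope.

(** * Homogeneous matrices *)

Section Homogeneous.
Variables (k : fieldType) (n : nat).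
Implicit Type p : {mpoly k[n]}.

(** Entries of a degree 0 map between graded free modules, from a basis element
    of degree a to one of degree b: homogeneous of degree a - b, and zero when
    a < b.  Adding b on the left avoids the truncated subtraction. *)
Definition homog_entry (a b : nat) p :=
  forall m, m \in msupp p -> (mdeg m + b)%N = a.

Definition hpart (a b : nat) p : {mpoly k[n]} :=
  \sum_(m <- msupp p | (mdeg m + b == a)%N) p@_m *: 'X_[m].

Lemma mcoeff_hpart a b p m :
  (hpart a b p)@_m = p@_m *+ (mdeg m + b == a)%N.
Proof.
rewrite /hpart raddf_sum /=.
have [m_p|/memN_msupp_eq0 p0] := boolP (m \in msupp p); last first.
  rewrite p0 mul0rn big1_seq // => m' /andP[_ m'_p].
  rewrite mcoeffZ mcoeffX; case: eqP => [e|]; last by rewrite mulr0.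
  by move: m'_p; rewrite mcoeff_msupp e p0 eqxx.
rewrite -big_filter.
have [e|e] := boolP (mdeg m + b == a)%N.
  rewrite (bigD1_seq m) ?mem_filter ?e ?filter_uniq //=.
  rewrite mcoeffZ mcoeffX eqxx mulr1 big1 ?addr0 // => m' /negPf ne.
  by rewrite mcoeffZ mcoeffX ne mulr0.
rewrite big1_seq // => m' /andP[_]; rewrite mem_filter => /andP[e' _].
rewrite mcoeffZ mcoeffX; case: eqP => [e1|]; last by rewrite mulr0.
by move: e; rewrite -e1 e'.
Qed.

Lemma homog_entryP a b p :
  homog_entry a b p <-> (forall m, (mdeg m + b != a)%N -> p@_m = 0).
Proof.
split=> h m.
  move=> ne; apply/eqP; rewrite mcoeff_eq0.
  by apply: contra ne => /h ->.
rewrite mcoeff_msupp => nz; apply/eqP; apply: contraNT nz => /h ->.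
by rewrite eqxx.
Qed.

Lemma hpart_id a b p : homog_entry a b p -> hpart a b p = p.
Proof.
move=> /homog_entryP h; apply/mpolyP => m; rewrite mcoeff_hpart.
by case: (boolP (_ == _)) => [|/h ->]; rewrite ?mul0rn.
Qed.

Lemma hpart_homog a b p : homog_entry a b (hpart a b p).
Proof. by apply/homog_entryP => m /negPf; rewrite mcoeff_hpart => ->. Qed.

Lemma hpart_is_additive a b : zmod_morphism (hpart a b).
Proof.
by move=> p q; apply/mpolyP => m; rewrite mcoeffB !mcoeff_hpart mcoeffB mulrnBl.
Qed.
HB.instance Definition _ a b :=
  GRing.isZmodMorphism.Build {mpoly k[n]} {mpoly k[n]} (hpart a b)
    (hpart_is_additive a b).

(** Taking the degree 0 part of a map commutes with composing by a degree 0 map;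
    this is what turns arbitrary lifts into homogeneous ones. *)
Lemma hpartM a b c p (q : {mpoly k[n]}) : homog_entry b c q ->
  hpart a c (p * q) = hpart a b p * q.
Proof.
move=> hq; apply/mpolyP => m; rewrite mcoeff_hpart !mcoeffM -sumrMnl.
apply: eq_bigr => -[/= m1 m2] /eqP e; rewrite mcoeff_hpart mulrnAl.
have [/hq|/memN_msupp_eq0 ->] := boolP (bmnm m2 \in msupp q); last first.
  by rewrite !mulr0 !mul0rn.
by move=> <-; rewrite addnA -mdegD -e.
Qed.

Lemma homog_entry0 a b : homog_entry a b 0.
Proof. by move=> m; rewrite msupp0. Qed.

Lemma homog_entryD a b p (q : {mpoly k[n]}) :
  homog_entry a b p -> homog_entry a b q -> homog_entry a b (p + q).
Proof. by move=> hp hq m /msuppD_le; rewrite mem_cat => /orP[/hp|/hq]. Qed.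

Lemma homog_entryN a b p : homog_entry a b p -> homog_entry a b (- p).
Proof. by move=> hp m; rewrite (perm_mem (msuppN _)); apply: hp. Qed.

Lemma homog_entryM a b c p (q : {mpoly k[n]}) :
  homog_entry a b p -> homog_entry b c q -> homog_entry a c (p * q).
Proof.
move=> hp hq m /msuppM_le /allpairsP[[m1 m2] [/= /hp <- /hq <- ->]].
by rewrite mdegD addnA.
Qed.

Lemma homog_entry_sum a b (J : finType) (P : pred J) (f : J -> {mpoly k[n]}) :
  (forall j, P j -> homog_entry a b (f j)) ->
  homog_entry a b (\sum_(j | P j) f j).
Proof.
by move=> h; apply: (big_ind (homog_entry a b));
  [apply: homog_entry0 | apply: homog_entryD | ].
Qed.

Definition homog_mx r q (da : 'I_r -> nat) (db : 'I_q -> nat)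
  (X : 'M[{mpoly k[n]}]_(r, q)) := forall s t, homog_entry (da s) (db t) (X s t).

Definition hpart_mx r q (da : 'I_r -> nat) (db : 'I_q -> nat)
    (X : 'M[{mpoly k[n]}]_(r, q)) : 'M_(r, q) :=
  \matrix_(s, t) hpart (da s) (db t) (X s t).

Section Matrices.
Variables (r q l : nat).
Variables (da : 'I_r -> nat) (db : 'I_q -> nat) (dc : 'I_l -> nat).

Lemma hpart_mx_homog X : homog_mx da db (hpart_mx da db X).
Proof. by move=> s t; rewrite mxE; apply: hpart_homog. Qed.

Lemma hpart_mx_id X : homog_mx da db X -> hpart_mx da db X = X.
Proof. by move=> h; apply/matrixP => s t; rewrite mxE hpart_id. Qed.

Lemma hpart_mxM (X : 'M_(r, q)) (Y : 'M_(q, l)) : homog_mx db dc Y ->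
  hpart_mx da dc (X *m Y) = hpart_mx da db X *m Y.
Proof.
move=> hY; apply/matrixP => s t; rewrite !mxE raddf_sum /=.
by apply: eq_bigr => j _; rewrite mxE; apply: hpartM.
Qed.

Lemma homog_mxM (X : 'M_(r, q)) (Y : 'M_(q, l)) :
  homog_mx da db X -> homog_mx db dc Y -> homog_mx da dc (X *m Y).
Proof.
move=> hX hY s t; rewrite mxE; apply: homog_entry_sum => j _.
exact: homog_entryM.
Qed.

Lemma homog_mx0 : homog_mx da db 0.
Proof. by move=> s t; rewrite mxE; apply: homog_entry0. Qed.

Lemma homog_mxN X : homog_mx da db X -> homog_mx da db (- X).
Proof. by move=> h s t; rewrite mxE; apply: homog_entryN. Qed.

Lemma homog_mxB X Y :
  homog_mx da db X -> homog_mx da db Y -> homog_mx da db (X - Y).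
Proof.
by move=> hX hY s t; rewrite !mxE; apply/homog_entryD/homog_entryN.
Qed.

End Matrices.

Lemma homog_mx1 r (da : 'I_r -> nat) : homog_mx da da 1%:M.
Proof.
move=> s t m; rewrite mxE; case: eqP => [->|_]; last by rewrite msupp0.
by rewrite msupp1 inE => /eqP ->; rewrite mdeg0.
Qed.

Definition constmx r q (c : 'M[k]_(r, q)) : 'M[{mpoly k[n]}]_(r, q) :=
  map_mx (@mpolyC n k) c.

(** The k-linear relations among the rows of X form the kernel of the matrix V of
    all coefficients of X, and P = V V^+ satisfies P V = V and has the same kernel. *)
Lemma row_relations r q (X : 'M[{mpoly k[n]}]_(r, q)) :
  exists P : 'M[k]_r, constmx P *m X = X /\
    forall c : 'rV[k]_r, constmx c *m X = 0 -> c *m P = 0.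
Proof.
pose N := (\max_s \max_t msize (X s t))%N.
have hN s t : (msize (X s t) <= N)%N.
  by apply: leq_trans (leq_bigmax s); apply: (leq_bigmax (F := fun t => msize (X s t))).
pose T := ('I_q * 'X_{1..n < N})%type.
pose mon (x : T) : 'X_{1..n} := x.2.
pose V : 'M[k]_(r, #|{: T}|) :=
  \matrix_(s, x) (X s (enum_val x).1)@_(mon (enum_val x)).
have coefV l (c : 'M[k]_(l, r)) s (x : T) :
    (c *m V) s (enum_rank x) = ((constmx c *m X) s x.1)@_(mon x).
  rewrite !mxE raddf_sum /=; apply: eq_bigr => j _.
  by rewrite !mxE enum_rankK mcoeffCM.
exists (V *m pinvmx V); split=> [|c c0].
  apply/matrixP => s t; apply/mpolyP => m.
  have [ltm|lem] := ltnP (mdeg m) N; last first.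
    rewrite mxE raddf_sum /= big1 => [|j _]; last first.
      rewrite mxE mcoeffCM memN_msupp_eq0 ?mulr0 //.
      by apply/negP => /msize_mdeg_lt; rewrite ltnNge (leq_trans (hN _ _) lem).
    rewrite memN_msupp_eq0 //.
    by apply/negP => /msize_mdeg_lt; rewrite ltnNge (leq_trans (hN _ _) lem).
  have /= <- : _ = ((_ *m X) s t)@_m := coefV _ (V *m pinvmx V) s (t, BMultinom ltm).
  by rewrite mulmxKpV // mxE enum_rankK.
rewrite mulmxA; have -> : c *m V = 0; last by rewrite mul0mx.
apply/matrixP => s x; rewrite -[x]enum_valK.
by rewrite coefV c0 !mxE mcoeff0.
Qed.

(** Replacing an arbitrary lift U0 by P U0, with P from [row_relations], makes the
    lift depend k-linearly on the rows of X.  Only relations within one degree d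
    survive the passage to the homogeneous part. *)
Lemma homog_lift r q l (da : 'I_r -> nat) (db : 'I_q -> nat) (dc : 'I_l -> nat)
    (X : 'M_(r, q)) (D : 'M_(l, q)) :
  homog_mx da db X -> homog_mx dc db D ->
  (forall s, exists u, row s X = u *m D) ->
  exists U : 'M_(r, l), [/\ homog_mx da dc U, U *m D = X &
    forall (d : nat) (c : 'rV[k]_r), (forall s, da s != d -> c 0 s = 0) ->
      constmx c *m X = 0 -> constmx c *m U = 0].
Proof.
move=> hX hD /(_ _)/constructive_indefinite_description lift.
pose U0 := \matrix_s sval (lift s).
have U0D : U0 *m D = X.
  by apply/row_matrixP => s; rewrite row_mul rowK; case: (lift s).
have [P [PX Prel]] := row_relations X.
exists (hpart_mx da dc (constmx P *m U0)); split.
- exact: hpart_mx_homog.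
- by rewrite -(hpart_mxM _ _ hD) -mulmxA U0D PX hpart_mx_id.
move=> d c hc c0.
have cU0 : constmx c *m (constmx P *m U0) = 0.
  by rewrite mulmxA -map_mxM Prel // map_mx0 mul0mx.
have hcd : homog_mx (fun=> d) da (constmx c).
  move=> s t m; rewrite mxE ord1 msuppC; case: eqP => // /eqP nz.
  rewrite inE => /eqP ->; rewrite mdeg0 add0n.
  by apply/eqP; apply: contraNT nz => /hc ->.
apply/matrixP => s t.
transitivity (hpart d (dc t) ((constmx c *m (constmx P *m U0)) s t)); last first.
  by rewrite cU0 !mxE raddf0.
rewrite [in RHS]mxE raddf_sum mxE; apply: eq_bigr => j _ /=; rewrite [hpart_mx _ _ _ _ _]mxE.
rewrite [constmx c s j]mxE ord1.
have [<-|/hc ->] := eqVneq (da j) d; last by rewrite mpolyC0 !mul0r raddf0.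
by rewrite !mul_mpolyC; apply/mpolyP => m; rewrite mcoeffZ !mcoeff_hpart mcoeffZ mulrnAr.
Qed.

End Homogeneous.

(** * Comparison of resolutions *)

Lemma dependent_choice (T : nat -> Type) (P : forall i, T i -> Prop)
    (R : forall i, T i -> T i.+1 -> Prop) (x0 : T 0%N) :
  P 0%N x0 -> (forall i x, P i x -> exists y, P i.+1 y /\ R i x y) ->
  exists f : forall i, T i,
    [/\ f 0%N = x0, forall i, P i (f i) & forall i, R i (f i) (f i.+1)].
Proof.
move=> P0 step.
pose next i (x : {x | P i x}) :=
  constructive_indefinite_description _ (step i (sval x) (svalP x)).
pose fix F i : {x | P i x} := match i with
  | 0%N => exist _ x0 P0
  | i'.+1 => exist _ (sval (next i' (F i'))) (svalP (next i' (F i'))).1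
  end.
exists (fun i => sval (F i)); split=> // i; first exact: svalP.
exact: (svalP (next i (F i))).2.
Qed.

Section Resolutions.
Variables (k : fieldType) (n : nat).
Implicit Types I J : {mpoly k[n]} -> Prop.

Definition is_ideal I :=
  [/\ I 0, forall p q, I p -> I q -> I (p + q) & forall c p, I p -> I (c * p)].

Lemma is_idealN I p : is_ideal I -> I p -> I (- p).
Proof. by case=> _ _ hM hp; rewrite -mulN1r; apply: hM. Qed.

Lemma is_idealB I p q : is_ideal I -> I p -> I q -> I (p - q).
Proof. by move=> hI hp hq; have [_ hD _] := hI; apply: hD => //; apply: is_idealN. Qed.

Lemma is_ideal_sum I (T : finType) (f : T -> {mpoly k[n]}) :
  is_ideal I -> (forall t, I (f t)) -> I (\sum_t f t).
Proof. by case=> h0 hD _ h; apply: big_ind. Qed.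

Section OneResolution.
Variables (I : {mpoly k[n]} -> Prop) (F : graded_free_resolution I).

(** The augmentation plays the role of the differential out of degree 0, so that
    exactness reads the same in all degrees. *)
Definition frcycle i : 'rV[{mpoly k[n]}]_(frrank F i) -> Prop :=
  match i with
  | 0%N => fun v => I ((v *m fraug F) 0 0)
  | i'.+1 => fun v => v *m frdiff F i' = 0
  end.

Lemma frcycleP i v : @frcycle i v <-> exists u, v = u *m frdiff F i.
Proof. by case: i v => [|i] v; [apply: frexact0 | apply: frexactS]. Qed.

Lemma frdiffK i : frdiff F i.+1 *m frdiff F i = 0.
Proof.
apply/row_matrixP => s; rewrite row_mul row0.
by apply/frexactS; exists (delta_mx 0 s); rewrite rowE.
Qed.

Lemma fraug_mx_homog : homog_mx (@frdeg _ _ _ F 0) (fun=> 0%N) (fraug F).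
Proof. by move=> s t m; rewrite ord1 addn0 => /fraug_homog. Qed.

Lemma frdiff_mx_homog i :
  homog_mx (@frdeg _ _ _ F i.+1) (@frdeg _ _ _ F i) (frdiff F i).
Proof. by move=> s t m /frdiff_homog. Qed.

End OneResolution.

Section ChainMap.
Variables (I J : {mpoly k[n]} -> Prop).
Variables (F : graded_free_resolution I) (G : graded_free_resolution J).

Definition degree0_map (f : forall i, 'M[{mpoly k[n]}]_(frrank F i, frrank G i)) :=
  forall i, homog_mx (@frdeg _ _ _ F i) (@frdeg _ _ _ G i) (f i).

Definition chain_map (f : forall i, 'M[{mpoly k[n]}]_(frrank F i, frrank G i)) :=
  forall i, f i.+1 *m frdiff G i = frdiff F i *m f i.

(** Each step is a k-linear lift, which yields the last property; it is what
    forces the comparison with a linear resolution to be minimal later on. *)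
Lemma extend_chain_map (f0 : 'M[{mpoly k[n]}]_(frrank F 0, frrank G 0)) :
  homog_mx (@frdeg _ _ _ F 0) (@frdeg _ _ _ G 0) f0 ->
  (forall v, frcycle v -> frcycle (v *m f0)) ->
  exists f : forall i, 'M[{mpoly k[n]}]_(frrank F i, frrank G i),
  [/\ f 0%N = f0, degree0_map f, chain_map f &
      forall i d (c : 'rV[k]_(frrank F i.+1)),
        (forall s, frdeg s != d -> c 0 s = 0) ->
        constmx n c *m (frdiff F i *m f i) = 0 -> constmx n c *m f i.+1 = 0].
Proof.
move=> hf0 cf0.
pose P i (f : 'M[{mpoly k[n]}]_(frrank F i, frrank G i)) :=
  homog_mx (@frdeg _ _ _ F i) (@frdeg _ _ _ G i) f /\
  forall v, frcycle v -> frcycle (v *m f).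
pose R i (f : 'M[{mpoly k[n]}]_(frrank F i, frrank G i)) f' :=
  f' *m frdiff G i = frdiff F i *m f /\
  forall d (c : 'rV[k]_(frrank F i.+1)),
    (forall s, frdeg s != d -> c 0 s = 0) ->
    constmx n c *m (frdiff F i *m f) = 0 -> constmx n c *m f' = 0.
have [//|i f [hf cf]|f [f_0 hf Rf]] := @dependent_choice _ P R f0.
  have [s|f' [hf' f'd rel]] := homog_lift (homog_mxM (@frdiff_mx_homog _ F i) hf)
                              (@frdiff_mx_homog _ G i).
    apply/frcycleP; rewrite row_mul; apply: cf; apply/frcycleP.
    by exists (delta_mx 0 s); rewrite rowE.
  exists f'; split; last by split.
  split=> // v /= v0; rewrite -mulmxA f'd mulmxA.
  by rewrite (v0 : v *m frdiff F i = 0) mul0mx.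
exists f; split=> // i; first by have [] := hf i.
- by have [] := Rf i.
- by have [] := Rf i.
Qed.

(** The invariant d (e_i - h_i d) = 0 makes e_(i+1) - d h_i a cycle, hence
    liftable to h_(i+1). *)
Lemma null_homotopy (e : forall i, 'M[{mpoly k[n]}]_(frrank F i, frrank G i)) :
  degree0_map e -> chain_map e -> (forall v, frcycle (v *m e 0%N)) ->
  exists h : forall i, 'M[{mpoly k[n]}]_(frrank F i, frrank G i.+1),
  [/\ forall i, homog_mx (@frdeg _ _ _ F i) (@frdeg _ _ _ G i.+1) (h i),
      e 0%N = h 0%N *m frdiff G 0 &
      forall i, e i.+1 = frdiff F i *m h i + h i.+1 *m frdiff G i.+1].
Proof.
move=> he ce e0.
pose P i (h : 'M[{mpoly k[n]}]_(frrank F i, frrank G i.+1)) :=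
  homog_mx (@frdeg _ _ _ F i) (@frdeg _ _ _ G i.+1) h /\
  frdiff F i *m (e i - h *m frdiff G i) = 0.
pose R i (h : 'M[{mpoly k[n]}]_(frrank F i, frrank G i.+1)) h' :=
  e i.+1 = frdiff F i *m h + h' *m frdiff G i.+1.
have [s|h0 [hh0 h0d _]] := homog_lift (he 0%N) (@frdiff_mx_homog _ G 0%N).
  by apply/frcycleP; rewrite rowE.
have [|i h [hh dh]|h [h_0 Ph Rh]] := @dependent_choice _ P R h0.
- by split; rewrite // h0d subrr mulmx0.
- have hX : homog_mx (@frdeg _ _ _ F i.+1) (@frdeg _ _ _ G i.+1)
      (e i.+1 - frdiff F i *m h).
    exact/homog_mxB/(homog_mxM (@frdiff_mx_homog _ F i) hh).
  have [s|h' [hh' h'd _]] := homog_lift hX (@frdiff_mx_homog _ G i.+1).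
    apply/frcycleP; rewrite /= rowE -mulmxA mulmxBl ce -mulmxA -mulmxBr dh.
    exact: mulmx0.
  exists h'; split; last by rewrite /R h'd addrC subrK.
  by split=> //; rewrite h'd opprB addrC subrK mulmxA frdiffK mul0mx.
exists h; split=> // [i|]; first by have [] := Ph i.
by rewrite h_0 h0d.
Qed.

End ChainMap.

Lemma augmentation_lift I (F G : graded_free_resolution I) :
  is_ideal I -> (forall a b p, I p -> I (hpart a b p)) ->
  exists f0 : 'M_(frrank F 0, frrank G 0),
    homog_mx (@frdeg _ _ _ F 0) (@frdeg _ _ _ G 0) f0 /\
    forall v : 'rV_(frrank F 0), I ((v *m f0 *m fraug G - v *m fraug F) 0 0).
Proof.
move=> hI hIh.
have lift s := constructive_indefinite_description _ (fraug_surj G (fraug F s 0)).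
pose U0 := \matrix_s sval (lift s).
exists (hpart_mx (@frdeg _ _ _ F 0) (@frdeg _ _ _ G 0) U0).
split=> [|v]; first exact: hpart_mx_homog.
have hF := @fraug_mx_homog _ F; have hG := @fraug_mx_homog _ G.
rewrite -mulmxA -(hpart_mxM _ _ hG) -(hpart_mx_id hF) -mulmxBr mxE.
apply: is_ideal_sum => // s; have [_ _ hM] := hI; apply: hM.
rewrite !mxE -raddfB; apply: hIh.
have := svalP (lift s); rewrite mxE; congr (I (_ - _)).
by apply: eq_bigr => j _; rewrite mxE.
Qed.

Lemma subr_mxE r q (X Y : 'M[{mpoly k[n]}]_(r, q)) s t :
  (X - Y) s t = X s t - Y s t.
Proof. by rewrite !mxE. Qed.

Section Invariance.
Variables (I : {mpoly k[n]} -> Prop).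
Hypotheses (hI : is_ideal I) (hIh : forall a b p, I p -> I (hpart a b p)).
Implicit Types F G : graded_free_resolution I.

Lemma comparison F G : exists f : forall i, 'M_(frrank F i, frrank G i),
  [/\ degree0_map f, chain_map f &
      forall v : 'rV_(frrank F 0), I ((v *m f 0%N *m fraug G - v *m fraug F) 0 0)].
Proof.
have [f0 [hf0 af0]] := augmentation_lift F G hI hIh.
have [v /= Fv|f [e hf cf _]] := @extend_chain_map I I F G f0 hf0.
  by have [_ hD _] := hI; have := hD _ _ (af0 v) Fv; rewrite subr_mxE subrK.
by exists f; rewrite e.
Qed.

Local Notation cst := (map_mx (@mcoeff n k 0%MM)).

Lemma tor_part_comm (I1 I2 : {mpoly k[n]} -> Prop)
    (F : graded_free_resolution I1) (G : graded_free_resolution I2) i i' (j : nat)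
    (X : 'M_(frrank F i, frrank G i')) :
  homog_mx (@frdeg _ _ _ F i) (@frdeg _ _ _ G i') X ->
  tor_part F i j *m cst X = cst X *m tor_part G i' j.
Proof.
move=> hX; apply/matrixP => s t; rewrite mul_diag_mx mul_mx_diag !mxE.
case: (altP ((X s t)@_0%MM =P 0)) => [->|]; first by rewrite mulr0 mul0r.
by rewrite -mcoeff_msupp => /hX; rewrite mdeg0 add0n => ->; rewrite mulrC.
Qed.

Lemma tor_cyclesP F i j r (Z : 'M_(r, _)) :
  (Z <= tor_cycles F i.+1 j)%MS ->
  (Z <= tor_part F i.+1 j)%MS /\ Z *m tor_diff F i = 0.
Proof. by rewrite sub_capmx => /andP[? /sub_kermxP]. Qed.

Lemma tor_cycles_part F i j : (tor_cycles F i j <= tor_part F i j)%MS.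
Proof. by case: i => [|i] //=; rewrite capmxSl. Qed.

(** As g f is homotopic to the identity, cycles of F that f sends to boundaries of
    G are boundaries of F; the rest counts dimensions. *)
Lemma betti_le F G i j : (betti F i j <= betti G i j)%N.
Proof.
have [f [hf cf af]] := comparison F G; have [g [hg cg ag]] := comparison G F.
pose e i := f i *m g i - 1%:M.
have [|||h [hh h0 hS]] := @null_homotopy I I F F e.
- by move=> l; apply/homog_mxB/homog_mx1/homog_mxM/hg/hf.
- move=> l; rewrite /e mulmxBl mulmxBr mul1mx mulmx1 -mulmxA cg.
  by rewrite !mulmxA cf.
- move=> v /=; rewrite /e mulmxBr mulmxBl mulmx1 mulmxA.
  have [_ hD _] := hI; have := hD _ _ (ag (v *m f 0%N)) (af v).
  by rewrite !subr_mxE addrA subrK.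
have fZ : (tor_cycles F i j *m cst (f i) <= tor_cycles G i j)%MS.
  have fP : (tor_cycles F i j *m cst (f i) <= tor_part G i j)%MS.
    have /submxP[Y ->] := tor_cycles_part F i j.
    by rewrite -mulmxA (tor_part_comm _ (hf i)) mulmxA submxMl.
  case: i fP => [//|i] fP; rewrite sub_capmx fP /=.
  apply/sub_kermxP; rewrite -mulmxA -map_mxM cf map_mxM mulmxA.
  by have [_ ->] := tor_cyclesP (submx_refl (tor_cycles F i.+1 j)); rewrite mul0mx.
have zh r (z : 'M_(r, _)) : (z <= tor_cycles F i j)%MS ->
    z *m cst (e i) = z *m cst (h i) *m tor_diff F i.
  case: i {fZ} z => [|i] z zZ; first by rewrite h0 map_mxM mulmxA.
  have [_ zd] := tor_cyclesP zZ.
  by rewrite hS map_mxD !map_mxM mulmxDr mulmxA zd mul0mx add0r mulmxA.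
have fgB r (z : 'M_(r, _)) : (z <= tor_cycles F i j)%MS ->
    (z *m cst (f i) <= tor_boundaries G i j)%MS -> (z <= tor_boundaries F i j)%MS.
  move=> zZ zB; have <- : z *m cst (f i) *m cst (g i) - z *m cst (e i) = z.
    rewrite -mulmxA -map_mxM -mulmxBr -map_mxB /e opprB addrC subrK.
    by rewrite map_mx1 mulmx1.
  apply: addmx_sub.
    have gB : tor_boundaries G i j *m cst (g i) = cst (g i.+1) *m tor_boundaries F i j.
      rewrite /tor_boundaries -mulmxA -map_mxM -cg map_mxM mulmxA.
      by rewrite (tor_part_comm _ (hg i.+1)) -mulmxA.
    have /submxP[Y ->] := zB.
    by rewrite -mulmxA gB mulmxA submxMl.
  rewrite eqmx_opp (zh _ _ zZ).
  have /submxP[Y ->] := submx_trans zZ (tor_cycles_part F i j).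
  rewrite -[Y *m _ *m _]mulmxA (tor_part_comm _ (hh i)) mulmxA -[X in (X <= _)%MS]mulmxA.
  exact: submxMl.
set Z := tor_cycles F i j in fZ fgB *; set B := tor_boundaries F i j in fgB *.
set Z' := tor_cycles G i j in fZ *; set B' := tor_boundaries G i j in fgB *.
rewrite /betti -/Z -/B -/Z' -/B'.
have e1 := mxrank_mul_ker Z (cst (f i) *m cokermx B').
have e2 := mxrank_mul_ker Z' (cokermx B').
have l1 : (\rank (Z :&: kermx (cst (f i) *m cokermx B')) <= \rank B)%N.
  apply/mxrankS/fgB; first exact: capmxSl.
  rewrite submxE -mulmxA; apply/eqP/sub_kermxP; exact: capmxSr.
have l2 : (\rank B' <= \rank (Z' :&: kermx (cokermx B')))%N.
  apply: mxrankS; rewrite sub_capmx tor_boundaries_cycles /=.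
  by apply/sub_kermxP; rewrite mulmx_coker.
have l3 : (\rank (Z *m (cst (f i) *m cokermx B')) <= \rank (Z' *m cokermx B'))%N.
  by rewrite mulmxA; apply/mxrankS/submxMr.
lia.
Qed.

Lemma betti_invariant F G i j : betti F i j = betti G i j.
Proof. by apply/eqP; rewrite eqn_leq !betti_le. Qed.

End Invariance.
End Resolutions.

(** * Splitting off the variable x_0 *)

Section FirstVariable.
Variables (k : fieldType) (n : nat).
Implicit Types (p : {mpoly k[n.+1]}) (e : nat).
Local Notation A := {mpoly k[n.+1]}.
Local Notation A' := {mpoly k[n]}.
Local Notation X0 := ('X_ord0 : A).

Lemma mpoly_rmorph_ext m (S : comNzRingType) (f g : {rmorphism {mpoly k[m]} -> S}) :
  (forall c, f c%:MP = g c%:MP) -> (forall i, f 'X_i = g 'X_i) -> f =1 g.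
Proof.
move=> fgC fgX p; rewrite (mpolyE p) !rmorph_sum; apply: eq_bigr => i _.
rewrite -mul_mpolyC !rmorphM fgC mpolyXE_id !rmorph_prod; congr (_ * _).
by apply: eq_bigr => j _; rewrite !rmorphXn fgX.
Qed.

Definition shift_vars : A' -> A := mmap (@mpolyC _ _) (fun i => 'X_(lift ord0 i)).
HB.instance Definition _ := GRing.RMorphism.on shift_vars.

(** The isomorphism k[x_0, ..., x_n] = k[x_1, ..., x_n][x_0]. *)
Definition x0_poly : A -> {poly A'} :=
  mmap (polyC \o @mpolyC _ _)
       (fun i => if unlift ord0 i is Some j then ('X_j)%:P else 'X).
HB.instance Definition _ := GRing.RMorphism.on x0_poly.

Definition of_x0_poly (q : {poly A'}) : A := (map_poly shift_vars q).[X0].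

Lemma shift_varsC (c : k) : shift_vars c%:MP = c%:MP.
Proof. by rewrite /shift_vars mmapC. Qed.

Lemma shift_varsX i : shift_vars 'X_i = 'X_(lift ord0 i).
Proof. by rewrite /shift_vars mmapX mmap1U. Qed.

Lemma x0_polyC (c : k) : x0_poly c%:MP = c%:MP%:P.
Proof. by rewrite /x0_poly mmapC. Qed.

Lemma x0_poly_rim i : x0_poly 'X_(lift ord0 i) = ('X_i)%:P.
Proof. by rewrite /x0_poly mmapX mmap1U liftK. Qed.

Lemma x0_poly_x0 : x0_poly X0 = 'X.
Proof. by rewrite /x0_poly mmapX mmap1U unlift_none. Qed.

Lemma x0_poly_shift q : x0_poly (shift_vars q) = q%:P.
Proof.
pose f : {rmorphism A' -> {poly A'}} := x0_poly \o shift_vars.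
apply: (@mpoly_rmorph_ext _ _ f polyC) => [c|i] /=.
  by rewrite shift_varsC x0_polyC.
by rewrite shift_varsX x0_poly_rim.
Qed.

Lemma x0_polyK : cancel x0_poly of_x0_poly.
Proof.
pose f : {rmorphism A -> A} := horner_eval X0 \o map_poly shift_vars \o x0_poly.
apply: (@mpoly_rmorph_ext _ _ f idfun) => [c|i] /=; rewrite /horner_eval.
  by rewrite x0_polyC map_polyC hornerC /= shift_varsC.
have [j ->|->] := unliftP ord0 i.
  by rewrite x0_poly_rim map_polyC hornerC /= shift_varsX.
by rewrite x0_poly_x0 map_polyX hornerX.
Qed.

Lemma of_x0_polyK : cancel of_x0_poly x0_poly.
Proof.
move=> q; rewrite /of_x0_poly -horner_map /= x0_poly_x0 -map_poly_comp.
rewrite (eq_map_poly (g := polyC)); first exact: comp_polyXr.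
by move=> c /=; rewrite x0_poly_shift.
Qed.

Definition x0_coef e p : A' := (x0_poly p)`_e.

Lemma x0_coef_is_additive e : zmod_morphism (x0_coef e).
Proof. by move=> p p'; rewrite /x0_coef raddfB coefB. Qed.
HB.instance Definition _ e :=
  GRing.isZmodMorphism.Build A A' (x0_coef e) (x0_coef_is_additive e).

Definition x0_quo p : A := of_x0_poly (drop_poly 1 (x0_poly p)).

Lemma x0_coef_inj p (q : A) : (forall e, x0_coef e p = x0_coef e q) -> p = q.
Proof. by move=> h; apply: (can_inj x0_polyK); apply/polyP. Qed.

Lemma x0_coef_shiftM e c p : x0_coef e (shift_vars c * p) = c * x0_coef e p.
Proof. by rewrite /x0_coef rmorphM /= x0_poly_shift coefCM. Qed.

Lemma x0_coef_mul_shift e c p : x0_coef e (p * shift_vars c) = x0_coef e p * c.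
Proof. by rewrite mulrC x0_coef_shiftM mulrC. Qed.

Lemma x0_coef_shift e c : x0_coef e (shift_vars c) = if e == 0%N then c else 0.
Proof. by rewrite /x0_coef x0_poly_shift coefC. Qed.

Lemma x0_coef_x0M e p : x0_coef e (X0 * p) = if e is e'.+1 then x0_coef e' p else 0.
Proof. by rewrite /x0_coef rmorphM /= x0_poly_x0 mulrC coefMX; case: e. Qed.

Lemma x0_coef_quo e p : x0_coef e (x0_quo p) = x0_coef e.+1 p.
Proof. by rewrite /x0_coef of_x0_polyK coef_drop_poly addn1. Qed.

Lemma x0_split p : p = shift_vars (x0_coef 0 p) + X0 * x0_quo p.
Proof.
apply: x0_coef_inj => e; rewrite raddfD /= x0_coef_shift x0_coef_x0M.
by case: e => [|e] /=; rewrite ?addr0 // add0r x0_coef_quo.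
Qed.

Lemma shift_vars_coef0 q : (shift_vars q)@_0%MM = q@_0%MM.
Proof.
pose f : {rmorphism A' -> k} := mcoeff 0%MM \o shift_vars.
apply: (@mpoly_rmorph_ext _ _ f (mcoeff 0%MM)) => [c|i] /=.
  by rewrite shift_varsC !mcoeffC !eqxx.
by rewrite shift_varsX !mcoeffX -!mdeg_eq0 !mdeg1.
Qed.

Lemma homog_entry_shift a b q : homog_entry a b q -> homog_entry a b (shift_vars q).
Proof.
move=> hq; rewrite (mpolyE q) rmorph_sum /= big_seq.
apply: (big_ind (homog_entry a b)); [exact: homog_entry0|exact: homog_entryD|].
move=> m /hq hm m'; rewrite -mul_mpolyC rmorphM /= shift_varsC.
rewrite /shift_vars mmapX /mmap1.
under eq_bigr do rewrite mpolyXn.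
rewrite mprodXE.
rewrite mul_mpolyC => /msuppZ_le; rewrite msuppX inE => /eqP ->.
rewrite mdeg_sum -hm mdegE; congr (_ + _)%N.
by apply: eq_bigr => i _; rewrite mdegMn mdeg1 mul1n.
Qed.

(** Dividing by x_0 lowers the degree in x_0 of all entries, so it reaches 0. *)
Lemma x0_ind r q (P : 'M[A]_(r, q) -> Prop) : P 0 ->
  (forall v, P (map_mx x0_quo v) -> P v) -> forall v, P v.
Proof.
move=> P0 Pquo v.
have [N hN] : exists N, forall s t, (size (x0_poly (v s t)) <= N)%N.
  exists (\max_s \max_t size (x0_poly (v s t)))%N => s t.
  by apply: leq_trans (leq_bigmax s);
     apply: (leq_bigmax (F := fun t => size (x0_poly (v s t)))).
elim: N v hN => [|N IH] v hN.
  have -> : v = 0; last by [].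
  apply/matrixP => s t; rewrite mxE; apply: (can_inj x0_polyK).
  by apply/eqP; rewrite rmorph0 -size_poly_eq0 -leqn0.
by apply/Pquo/IH => s t; rewrite mxE of_x0_polyK size_drop_poly; have := hN s t; lia.
Qed.

Lemma x0_split_mx r q (v : 'M[A]_(r, q)) :
  v = map_mx shift_vars (map_mx (x0_coef 0) v) + X0 *: map_mx x0_quo v.
Proof. by apply/matrixP => s t; rewrite !mxE -x0_split. Qed.

Lemma x0_coef_mxM e r q l (v : 'M[A]_(r, q)) (D : 'M[A']_(q, l)) :
  map_mx (x0_coef e) (v *m map_mx shift_vars D) = map_mx (x0_coef e) v *m D.
Proof.
apply/matrixP => s t; rewrite !mxE raddf_sum; apply: eq_bigr => j _ /=.
by rewrite !mxE x0_coef_mul_shift.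
Qed.

Lemma x0_coef_quo_mx e r q (v : 'M[A]_(r, q)) :
  map_mx (x0_coef e) (map_mx x0_quo v) = map_mx (x0_coef e.+1) v.
Proof. by apply/matrixP => s t; rewrite !mxE x0_coef_quo. Qed.

Lemma x0_coef_mx_inj r q (v w : 'M[A]_(r, q)) :
  (forall e, map_mx (x0_coef e) v = map_mx (x0_coef e) w) -> v = w.
Proof.
move=> h; apply/matrixP => s t; apply: x0_coef_inj => e.
by move/matrixP/(_ s t): (h e); rewrite [LHS]mxE [RHS]mxE.
Qed.

Lemma x0_coef_x0_mx e r q (v : 'M[A]_(r, q)) :
  map_mx (x0_coef e) (X0 *: v) = if e is e'.+1 then map_mx (x0_coef e') v else 0.
Proof.
by apply/matrixP => s t; rewrite !mxE x0_coef_x0M; case: e => [|e]; rewrite !mxE.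
Qed.

Section BaseChange.
Variables (I : A' -> Prop) (F : graded_free_resolution I).

(** A'[x_0] is free over A', so extension of scalars keeps F exact: cycles can be
    lifted one power of x_0 at a time. *)
Lemma shift_frcycle_lift i (v : 'rV[A]_(frrank F i)) :
  (forall e, frcycle (map_mx (x0_coef e) v)) ->
  exists u, v = u *m map_mx shift_vars (frdiff F i).
Proof.
elim/x0_ind: v => [|v IH] hv; first by exists 0; rewrite mul0mx.
have [|u hu] := IH; first by move=> e; rewrite x0_coef_quo_mx.
have /frcycleP[u0 hu0] := hv 0%N.
exists (map_mx shift_vars u0 + X0 *: u).
by rewrite mulmxDl -scalemxAl -hu -map_mxM -hu0 -x0_split_mx.
Qed.

Lemma shift_fraug_surj (w : 'M[A]_1) : I 0 ->
  exists v : 'rV[A]_(frrank F 0), forall e,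
    I ((map_mx (x0_coef e) v *m fraug F) 0 0 - x0_coef e (w 0 0)).
Proof.
move=> I0; elim/x0_ind: w => [|w [v hv]].
  by exists 0 => e; rewrite map_mx0 mul0mx !mxE raddf0 subrr.
have [v0 hv0] := fraug_surj F (x0_coef 0 (w 0 0)).
exists (map_mx shift_vars v0 + X0 *: v) => e.
rewrite map_mxD x0_coef_x0_mx; case: e => [|e] /=.
  rewrite addr0 -map_mx_comp map_mx_id // => p /=.
  by rewrite x0_coef_shift.
have -> : map_mx (x0_coef e.+1) (map_mx shift_vars v0) = 0.
  by apply/matrixP => s t; rewrite !mxE x0_coef_shift.
by rewrite add0r; have := hv e; rewrite [(map_mx _ w) 0 0]mxE x0_coef_quo.
Qed.
End BaseChange.

End FirstVariable.

(** * The cone resolving I + x_0 J *)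

Section Blocks.
Variables (k : fieldType) (n : nat).

Definition cat_deg r q (f : 'I_r -> nat) (g : 'I_q -> nat) (s : 'I_(r + q)) : nat :=
  match split s with inl s' => f s' | inr s' => g s' end.

Lemma cat_deg_lshift r q (f : 'I_r -> nat) (g : 'I_q -> nat) s :
  cat_deg f g (lshift q s) = f s.
Proof. by rewrite /cat_deg (unsplitK (inl s)). Qed.

Lemma cat_deg_rshift r q (f : 'I_r -> nat) (g : 'I_q -> nat) s :
  cat_deg f g (rshift r s) = g s.
Proof. by rewrite /cat_deg (unsplitK (inr s)). Qed.

Definition cat_degE := (cat_deg_lshift, cat_deg_rshift).

Lemma homog_col_mx r1 r2 q (d1 : 'I_r1 -> nat) (d2 : 'I_r2 -> nat) (dc : 'I_q -> nat)
    (X : 'M[{mpoly k[n]}]_(r1, q)) (Y : 'M_(r2, q)) :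
  homog_mx d1 dc X -> homog_mx d2 dc Y -> homog_mx (cat_deg d1 d2) dc (col_mx X Y).
Proof.
move=> hX hY s t; have [s' ->|s' ->] := split_ordP s; rewrite cat_degE.
  by rewrite col_mxEu.
by rewrite col_mxEd.
Qed.

Lemma homog_row_mx r q1 q2 (da : 'I_r -> nat) (d1 : 'I_q1 -> nat) (d2 : 'I_q2 -> nat)
    (X : 'M[{mpoly k[n]}]_(r, q1)) (Y : 'M_(r, q2)) :
  homog_mx da d1 X -> homog_mx da d2 Y -> homog_mx da (cat_deg d1 d2) (row_mx X Y).
Proof.
move=> hX hY s t; have [t' ->|t' ->] := split_ordP t; rewrite cat_degE.
  by rewrite row_mxEl.
by rewrite row_mxEr.
Qed.

Lemma homog_mx_succ r q (da : 'I_r -> nat) (db : 'I_q -> nat)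
    (X : 'M[{mpoly k[n]}]_(r, q)) :
  homog_mx da db X -> homog_mx (fun s => (da s).+1) (fun t => (db t).+1) X.
Proof. by move=> h s t m /h <-; rewrite addnS. Qed.

Lemma homog_mx_shift r q (da : 'I_r -> nat) (db : 'I_q -> nat)
    (X : 'M[{mpoly k[n]}]_(r, q)) :
  homog_mx da db X -> homog_mx da db (map_mx (@shift_vars k n) X).
Proof. by move=> h s t; rewrite mxE; apply: homog_entry_shift. Qed.

End Blocks.

Section Cone.
Variables (k : fieldType) (n : nat).
Local Notation A := {mpoly k[n.+1]}.
Local Notation A' := {mpoly k[n]}.
Local Notation X0 := ('X_ord0 : A).
Local Notation "M ^s" := (map_mx (@shift_vars k n) M) (at level 2, format "M ^s").

Section PreviousTerm.
Variables (I : A' -> Prop) (F : graded_free_resolution I).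

(** The complex F shifted by one homological degree, starting with a zero term. *)
Definition prev_rank i : nat := if i is i'.+1 then frrank F i' else 0.

Definition prev_deg i : 'I_(prev_rank i) -> nat :=
  match i with 0%N => fun=> 0%N | i'.+1 => @frdeg _ _ _ F i' end.

Definition prev_diff i : 'M[A']_(frrank F i, prev_rank i) :=
  match i with 0%N => 0 | i'.+1 => frdiff F i' end.

Lemma prev_diff_homog i : homog_mx (@frdeg _ _ _ F i) (@prev_deg i) (prev_diff i).
Proof. by case: i => [|i] /=; [apply: homog_mx0 | apply: frdiff_mx_homog]. Qed.

Lemma prev_diffK i : frdiff F i *m prev_diff i = 0.
Proof. by case: i => [|i] /=; rewrite ?mulmx0 ?frdiffK. Qed.

End PreviousTerm.

(** L is the ideal I + x_0 J[x_0]. *)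
Variables (I J : A' -> Prop) (L : A -> Prop).
Variables (F : graded_free_resolution I) (K : graded_free_resolution J).
Variable psi : forall i, 'M[A']_(frrank F i, frrank K i).
Hypotheses (hI : is_ideal I) (hJ : is_ideal J) (IJ : forall p, I p -> J p).
Hypothesis LE : forall p,
  L p <-> I (x0_coef 0 p) /\ forall e, J (x0_coef e.+1 p).
Hypotheses (psi_homog : degree0_map psi) (psi_chain : chain_map psi).
Hypothesis psi_aug : forall v : 'rV_(frrank F 0),
  J ((v *m fraug F) 0 0 - (v *m psi 0%N *m fraug K) 0 0).

Definition cone_rank i := (frrank F i + (frrank K i + prev_rank F i))%N.

Definition cone_deg i : 'I_(cone_rank i) -> nat :=
  cat_deg (@frdeg _ _ _ F i)
    (cat_deg (fun s => (@frdeg _ _ _ K i s).+1) (fun s => (@prev_deg _ F i s).+1)).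

Definition cone_aug : 'cV[A]_(cone_rank 0) :=
  col_mx (fraug F)^s (col_mx (- (X0 *: (fraug K)^s)) 0).

Definition cone_diff i : 'M[A]_(cone_rank i.+1, cone_rank i) :=
  block_mx (frdiff F i)^s 0
           (col_mx 0 X0%:M)
           (block_mx (frdiff K i)^s 0 (psi i)^s (- (prev_diff F i)^s)).

Lemma mul_cone_diff i (a : 'rV_(frrank F i.+1)) (c : 'rV_(frrank K i.+1)) (b : 'rV_(frrank F i)) :
  row_mx a (row_mx c b) *m cone_diff i =
  row_mx (a *m (frdiff F i)^s + X0 *: b)
         (row_mx (c *m (frdiff K i)^s + b *m (psi i)^s) (- (b *m (prev_diff F i)^s))).
Proof.
rewrite /cone_diff mul_row_block mulmx0 add0r mul_row_col mulmx0 add0r mul_mx_scalar.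
by rewrite mul_row_block mulmx0 add0r mulmxN.
Qed.

Lemma mul_cone_aug (a : 'rV_(frrank F 0)) (c : 'rV_(frrank K 0)) (b : 'rV_0) :
  row_mx a (row_mx c b) *m cone_aug = a *m (fraug F)^s - X0 *: (c *m (fraug K)^s).
Proof. by rewrite !mul_row_col mulmx0 addr0 mulmxN scalemxAr. Qed.

Lemma x0_coef_entry e r q (X : 'M[A]_(r, q)) s t :
  x0_coef e (X s t) = map_mx (x0_coef e) X s t.
Proof. by rewrite mxE. Qed.

Lemma sub_x0_mxE r q (X Y : 'M[A]_(r, q)) s t :
  (X - X0 *: Y) s t = X s t - X0 * Y s t.
Proof. by rewrite !mxE. Qed.

Lemma cone_split i (v : 'rV[A]_(cone_rank i)) :
  exists (a : 'rV_(frrank F i)) (c : 'rV_(frrank K i)) (b : 'rV_(prev_rank F i)),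
    v = row_mx a (row_mx c b).
Proof.
by exists (lsubmx v), (lsubmx (rsubmx v)), (rsubmx (rsubmx v)); rewrite !hsubmxK.
Qed.

(** Exactness in all degrees at once.  Writing a = a_0 + x_0 a_+, the component
    x_0 b of the differential reaches x_0 a_+ without any lifting in F; what is
    left to lift is the cycle a_0 of F and a cycle of K with coefficients in A. *)
Lemma cone_lift i (a : 'rV[A]_(frrank F i)) (c : 'rV[A]_(frrank K i))
    (b : 'rV[A]_(prev_rank F i)) :
  frcycle (map_mx (x0_coef 0) a) ->
  (forall e, frcycle (map_mx (x0_coef e) (c - map_mx (@x0_quo _ _) a *m (psi i)^s))) ->
  b = - (map_mx (@x0_quo _ _) a *m (prev_diff F i)^s) ->
  exists u, row_mx a (row_mx c b) = u *m cone_diff i.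
Proof.
move=> /frcycleP[a' ha'] /shift_frcycle_lift[c' hc'] ->.
exists (row_mx a'^s (row_mx c' (map_mx (@x0_quo _ _) a))).
by rewrite mul_cone_diff -hc' -map_mxM -ha' subrK -x0_split_mx.
Qed.

Lemma psi_shift_chain i : (psi i.+1)^s *m (frdiff K i)^s = (frdiff F i)^s *m (psi i)^s.
Proof. by rewrite -!map_mxM psi_chain. Qed.

Lemma cone_diffK i (u : 'rV_(cone_rank i.+2)) : u *m cone_diff i.+1 *m cone_diff i = 0.
Proof.
have [a [c [b ->]]] := cone_split u; rewrite !mul_cone_diff.
rewrite mulmxDl -mulmxA -map_mxM frdiffK map_mx0 mulmx0 add0r -scalemxAl scalerN subrr.
rewrite mulmxDl -!mulmxA -map_mxM frdiffK map_mx0 mulmx0 add0r mulNmx psi_shift_chain.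
rewrite !mulmxA subrr mulNmx -mulmxA -map_mxM prev_diffK map_mx0 mulmx0 !oppr0.
by rewrite !row_mx0.
Qed.

Lemma cone_augK (u : 'rV_(cone_rank 1)) : L ((u *m cone_diff 0 *m cone_aug) 0 0).
Proof.
have [a [c [b ->]]] := cone_split u; rewrite mul_cone_diff mul_cone_aug.
set p := (X in L (fun_of_matrix X _ _)).
have pE e : x0_coef e (p 0 0) = (map_mx (x0_coef e) p) 0 0 by rewrite [RHS]mxE.
apply/LE; split=> [|e]; rewrite pE /p map_mxB subr_mxE !mulmxDl.
  rewrite map_mxD -!scalemxAl !x0_coef_x0_mx addr0 [in X in _ - X]mxE subr0.
  rewrite !x0_coef_mxM.
  by apply/frexact0; eexists.
rewrite map_mxD -!scalemxAl !x0_coef_x0_mx map_mxD !x0_coef_mxM.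
have JF (v : 'rV_(frrank F 1)) : J ((v *m frdiff F 0 *m fraug F) 0 0).
  by apply/IJ/frexact0; eexists.
have JK (v : 'rV_(frrank K 1)) : J ((v *m frdiff K 0 *m fraug K) 0 0).
  by apply/frexact0; eexists.
set bb := map_mx (x0_coef e) b.
rewrite [in X in X - _]mxE [in X in _ - X]mxE opprD addrACA.
have [_ hD _] := hJ; apply: hD.
  exact: is_idealB.
exact: psi_aug.
Qed.

Lemma cone_exact0 (v : 'rV_(cone_rank 0)) :
  L ((v *m cone_aug) 0 0) <-> exists u, v = u *m cone_diff 0.
Proof.
split=> [|[u ->]]; last exact: cone_augK.
have [a [c [b ->]]] := cone_split v; rewrite mul_cone_aug => /LE[h0 hS].
apply: cone_lift => [|e|]; last by rewrite [LHS]thinmx0 [RHS]thinmx0.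
  move: h0; rewrite sub_x0_mxE raddfB /= x0_coef_x0M subr0.
  by rewrite /= -x0_coef_mxM [X in _ -> I X]mxE.
have [_ hD _] := hJ.
have := hS e; rewrite sub_x0_mxE raddfB /= x0_coef_x0M => h.
have := hD _ _ (is_idealN hJ h) (psi_aug (map_mx (x0_coef e.+1) a)).
rewrite !x0_coef_entry !x0_coef_mxM opprB addrA subrK.
by rewrite /= map_mxB x0_coef_mxM x0_coef_quo_mx mulmxBl subr_mxE.
Qed.

Lemma cone_exactS i (v : 'rV_(cone_rank i.+1)) :
  v *m cone_diff i = 0 <-> exists u, v = u *m cone_diff i.+1.
Proof.
split=> [|[u ->]]; last exact: cone_diffK.
have [a [c [b ->]]] := cone_split v; rewrite mul_cone_diff.
move=> /eqP; rewrite -[0]row_mx0 => /eqP/eq_row_mx[ha].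
rewrite -[0]row_mx0 => /eq_row_mx[hc hb].
have ae e : map_mx (x0_coef e.+1) a *m frdiff F i = - map_mx (x0_coef e) b.
  have /(congr1 (map_mx (x0_coef e.+1))) := ha.
  rewrite map_mx0 map_mxD x0_coef_x0_mx x0_coef_mxM => /eqP.
  by rewrite addr_eq0 => /eqP.
apply: cone_lift => [|e|] /=.
- have /(congr1 (map_mx (x0_coef 0))) := ha.
  by rewrite map_mx0 map_mxD x0_coef_x0_mx x0_coef_mxM addr0.
- rewrite map_mxB x0_coef_mxM x0_coef_quo_mx mulmxBl -mulmxA psi_chain mulmxA ae.
  rewrite mulNmx opprK -!x0_coef_mxM -map_mxD hc; exact: map_mx0.
apply: x0_coef_mx_inj => e.
by rewrite map_mxN x0_coef_mxM x0_coef_quo_mx ae opprK.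
Qed.

Lemma cone_diff_homog i : homog_mx (@cone_deg i.+1) (@cone_deg i) (cone_diff i).
Proof.
apply: homog_col_mx; apply: homog_row_mx.
- exact/homog_mx_shift/frdiff_mx_homog.
- exact: homog_mx0.
- apply: homog_col_mx; first exact: homog_mx0.
  move=> s t m; rewrite mxE; case: eqP => [->|_]; last by rewrite msupp0.
  by rewrite mulr1n msuppX inE => /eqP ->; rewrite mdeg1 add1n.
apply: homog_col_mx; apply: homog_row_mx.
- exact/homog_mx_succ/homog_mx_shift/frdiff_mx_homog.
- exact: homog_mx0.
- exact/homog_mx_succ/homog_mx_shift/psi_homog.
- exact/homog_mx_succ/homog_mxN/homog_mx_shift/prev_diff_homog.
Qed.

Lemma cone_aug_homog s m : m \in msupp (cone_aug s 0) -> mdeg m = cone_deg s.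
Proof.
have h : homog_mx (@cone_deg 0) (fun=> 0%N) cone_aug.
  apply: homog_col_mx; first exact/homog_mx_shift/fraug_mx_homog.
  apply: homog_col_mx; last exact: homog_mx0.
  apply: homog_mxN => s' t; rewrite mxE mulrC.
  apply: homog_entryM (_ : homog_entry 1 0 X0).
    exact/(homog_mx_succ (homog_mx_shift (@fraug_mx_homog _ _ _ K))).
  by move=> m'; rewrite msuppX inE => /eqP ->; rewrite mdeg1.
by move=> /h; rewrite addn0.
Qed.

Lemma cone_aug_surj p : exists v : 'rV_(cone_rank 0), L ((v *m cone_aug) 0 0 - p).
Proof.
have [I0 _ _] := hI; have [v hv] := shift_fraug_surj F (const_mx p) I0.
exists (row_mx v (row_mx 0 0)); rewrite mul_cone_aug mul0mx scaler0 subr0.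
have hL e : I (x0_coef e ((v *m (fraug F)^s) 0 0 - p)).
  have := hv e; rewrite [const_mx _ _ _]mxE -x0_coef_mxM [(map_mx _ _) 0 0]mxE.
  by rewrite raddfB.
by apply/LE; split=> // e; apply/IJ.
Qed.

Definition cone : graded_free_resolution L :=
  @GradedFreeResolution k n.+1 L cone_rank cone_deg cone_aug cone_diff
    cone_aug_homog cone_diff_homog cone_aug_surj cone_exact0 cone_exactS.

End Cone.

(** * The Koszul resolution of k *)

Section Koszul.
Variable k : fieldType.

Definition irrelevant n (p : {mpoly k[n]}) : Prop := p@_0%MM = 0.

Lemma irrelevant_ideal n : is_ideal (@irrelevant n).
Proof.
split; rewrite /irrelevant; first by rewrite mcoeff0.
  by move=> p q hp hq; rewrite mcoeffD hp hq addr0.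
by move=> c p hp; rewrite rmorphM /= hp mulr0.
Qed.

Lemma irrelevant_x0 n (p : {mpoly k[n.+1]}) :
  irrelevant p <-> irrelevant (x0_coef 0 p).
Proof.
rewrite /irrelevant {1}[p]x0_split mcoeffD shift_vars_coef0 rmorphM /=.
by rewrite mcoeffX -mdeg_eq0 mdeg1 mul0r addr0.
Qed.

Section ConstantResolution.
Variables (n : nat) (r : nat) (I : {mpoly k[n]} -> Prop).
Hypothesis I_surj : forall p, exists v : 'rV_r, I ((v *m const_mx 1 : 'M_1) 0 0 - p).
Hypothesis I_inj : forall v : 'rV_r, I ((v *m const_mx 1 : 'M_1) 0 0) <-> v = 0.

Definition constant_rank i := if i is 0%N then r else 0%N.

Lemma constant_aug_homog (s : 'I_(constant_rank 0)) m :
  m \in msupp ((const_mx 1 : 'cV[{mpoly k[n]}]_r) s 0) -> mdeg m = 0%N.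
Proof. by rewrite mxE msupp1 inE => /eqP ->; rewrite mdeg0. Qed.

Lemma constant_diff_homog i (s : 'I_(constant_rank i.+1)) (t : 'I_(constant_rank i)) m :
  m \in msupp ((0 : 'M[{mpoly k[n]}]_(constant_rank i.+1, constant_rank i)) s t) ->
  (mdeg m + 0)%N = 0%N.
Proof. by case: s. Qed.

Lemma constant_exact0 (v : 'rV_(constant_rank 0)) :
  I ((v *m const_mx 1 : 'M_1) 0 0) <->
  exists u : 'rV_(constant_rank 1), v = u *m (0 : 'M[{mpoly k[n]}]_(_, constant_rank 0)).
Proof.
apply: (iff_trans (I_inj v)); split=> [->|[u ->]]; last by rewrite mulmx0.
by exists 0; rewrite mulmx0.
Qed.

Lemma constant_exactS i (v : 'rV_(constant_rank i.+1)) :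
  v *m (0 : 'M[{mpoly k[n]}]_(_, constant_rank i)) = 0 <->
  exists u : 'rV_(constant_rank i.+2), v = u *m 0.
Proof. by split=> _; [exists 0; apply/rowP => -[] | rewrite mulmx0]. Qed.

(** Two cases feed the construction of the Koszul resolution: r = 0 resolves the
    zero module, and r = 1 resolves k over itself. *)
Definition constant_resolution : graded_free_resolution I :=
  @GradedFreeResolution k n I constant_rank (fun _ _ => 0%N) (const_mx 1) (fun _ => 0)
    constant_aug_homog constant_diff_homog I_surj constant_exact0 constant_exactS.
End ConstantResolution.

(** Passing from n to n + 1 variables is the cone on multiplication by x_0; the
    ranks obey Pascal's rule. *)
Lemma koszul n : exists K : graded_free_resolution (@irrelevant n),
  [/\ forall i, frrank K i = 'C(n, i), forall i (s : 'I_(frrank K i)), frdeg s = i &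
      forall s, fraug K s 0 = 1].
Proof.
elim: n => [|n [K [rkK degK augK]]].
  have inj (p : {mpoly k[0]}) : p@_0%MM = 0 -> p = 0.
    move=> p0; apply/mpolyP => m; rewrite mcoeff0 -p0; congr (_ @_ _).
    by apply/mnmP; case.
  have e (v : 'rV_1) : (v *m const_mx 1 : 'M_1) 0 0 = v 0 0 :> {mpoly k[0]}.
    by rewrite mxE big_ord1 mxE mulr1.
  have surj (p : {mpoly k[0]}) :
      exists v : 'rV_1, irrelevant ((v *m const_mx 1 : 'M_1) 0 0 - p).
    by exists (const_mx p); rewrite e mxE subrr /irrelevant mcoeff0.
  have inj1 (v : 'rV[{mpoly k[0]}]_1) :
      irrelevant ((v *m const_mx 1 : 'M_1) 0 0) <-> v = 0.
    rewrite e; split=> [/inj v0|->]; last by rewrite mxE /irrelevant mcoeff0.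
    by apply/rowP => s; rewrite !ord1 v0 mxE.
  exists (constant_resolution surj inj1); split.
  - by case=> [|i]; rewrite bin0n.
  - by case=> [|i] [].
  by move=> s /=; rewrite mxE.
have surj (p : {mpoly k[n]}) : exists v : 'rV[{mpoly k[n]}]_0, True by exists 0.
have inj0 (v : 'rV[{mpoly k[n]}]_0) : True <-> v = 0 by rewrite [v]thinmx0.
pose Z := @constant_resolution n 0 (fun=> True) surj inj0.
pose psi i : 'M[{mpoly k[n]}]_(frrank K i, frrank Z i) := 0.
have Z0 i : 'I_(frrank Z i) -> False by case: i => [|i] [].
have pdeg i (t : 'I_(prev_rank K i)) : (prev_deg t).+1 = i.
  by case: i t => [|i] t; [case: t | rewrite /= degK].
have LE (p : {mpoly k[n.+1]}) :
    irrelevant p <-> irrelevant (x0_coef 0 p) /\ forall e : nat, True.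
  by rewrite irrelevant_x0; split=> [|[]].
have idT : is_ideal (fun _ : {mpoly k[n]} => True) by [].
have homT : degree0_map psi by move=> i; apply: homog_mx0.
have chT : chain_map psi by move=> i; rewrite mul0mx mulmx0.
exists (cone (irrelevant_ideal n) idT (fun _ _ => I) LE homT chT (fun _ => I)).
split=> [i|i s|s] /=.
- by rewrite /cone_rank; case: i => [|i] /=; rewrite !rkK ?bin0 // binS.
- rewrite /cone_deg; have [s' ->|s' ->] := split_ordP s; rewrite cat_degE ?degK //.
  by have [t|t ->] := split_ordP s'; [case: (Z0 _ t) | rewrite cat_degE pdeg].
rewrite /cone_aug; have [s' ->|[] //] := split_ordP s.
by rewrite col_mxEu mxE augK rmorph1.
Qed.

End Koszul.

(** * Betti numbers of the cone *)

Section Ranks.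
Variables (k : fieldType) (n : nat) (I : {mpoly k[n]} -> Prop).
Variable F : graded_free_resolution I.

Definition prev_boundary_rank i j : nat :=
  if i is i'.+1 then \rank (tor_boundaries F i' j) else 0.

(** Counting dimensions without subtraction, to add up the blocks of the cone. *)
Lemma betti_rankE i j :
  (betti F i j + prev_boundary_rank i j + \rank (tor_boundaries F i j) =
   \rank (tor_part F i j))%N.
Proof.
have le := mxrankS (tor_boundaries_cycles F i j).
rewrite /betti; case: i le => [|i] /= le; first by lia.
have := mxrank_mul_ker (tor_part F i.+1 j) (tor_diff F i).
rewrite /tor_boundaries in le *; lia.
Qed.

Lemma linear_tor_part i j : (forall s : 'I_(frrank F i), frdeg s = i) ->
  \rank (tor_part F i j) = if i == j then frrank F i else 0%N.
Proof.
move=> h; have -> : tor_part F i j = ((i == j)%:R : k)%:M.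
  by apply/matrixP => s t; rewrite !mxE h.
by case: (i == j); rewrite ?mxrank1 // raddf0 mxrank0.
Qed.

Lemma linear_tor_diff i : (forall i (s : 'I_(frrank F i)), frdeg s = i) ->
  tor_diff F i = 0.
Proof.
move=> h; apply/matrixP => s t; rewrite !mxE; apply/eqP; rewrite mcoeff_eq0.
by apply/negP => /frdiff_homog; rewrite !h mdeg0; lia.
Qed.

End Ranks.

Section BettiCone.
Variables (k : fieldType) (n : nat).
Variables (I J : {mpoly k[n]} -> Prop) (L : {mpoly k[n.+1]} -> Prop).
Variables (F : graded_free_resolution I) (K : graded_free_resolution J).
Variable psi : forall i, 'M[{mpoly k[n]}]_(frrank F i, frrank K i).
Hypotheses (hI : is_ideal I) (hJ : is_ideal J) (IJ : forall p, I p -> J p).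
Hypothesis LE : forall p,
  L p <-> I (x0_coef 0 p) /\ forall e, J (x0_coef e.+1 p).
Hypotheses (psi_homog : degree0_map psi) (psi_chain : chain_map psi).
Hypothesis psi_aug : forall v : 'rV_(frrank F 0),
  J ((v *m fraug F) 0 0 - (v *m psi 0%N *m fraug K) 0 0).
Hypothesis K_linear : forall i (s : 'I_(frrank K i)), frdeg s = i.
Local Notation G := (cone hI hJ IJ LE psi_homog psi_chain psi_aug).
Local Notation cst := (map_mx (@mcoeff n k 0%MM)).

Definition prev_part i j : 'M[k]_(prev_rank F i) :=
  diag_mx (\row_s (@prev_deg _ _ _ F i s == j)%:R).

Lemma cone_tor_part i j : tor_part G i j.+1 =
  block_mx (tor_part F i j.+1) 0 0 (block_mx (tor_part K i j) 0 0 (prev_part i j)).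
Proof.
rewrite /tor_part /prev_part -!diag_mx_row; congr diag_mx.
apply/rowP => s; rewrite mxE /= /cone_deg.
have [t ->|t ->] := split_ordP s; rewrite cat_degE ?row_mxEl ?row_mxEr; first by rewrite mxE.
by have [t' ->|t' ->] := split_ordP t; rewrite cat_degE ?row_mxEl ?row_mxEr mxE eqSS.
Qed.

Lemma cst_shift r q (X : 'M[{mpoly k[n]}]_(r, q)) :
  map_mx (@mcoeff n.+1 k 0%MM) (map_mx (@shift_vars k n) X) = cst X.
Proof. by apply/matrixP => s t; rewrite !mxE shift_vars_coef0. Qed.

Lemma cone_tor_diff i : tor_diff G i =
  block_mx (tor_diff F i) 0 0 (block_mx 0 0 (cst (psi i)) (- cst (prev_diff F i))).
Proof.
rewrite /tor_diff /= /cone_diff map_block_mx map_col_mx map_block_mx map_mxN.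
rewrite !cst_shift !map_mx0 map_scalar_mx /= mcoeffX -mdeg_eq0 mdeg1 raddf0.
by rewrite [cst (frdiff K i)]linear_tor_diff // col_mx0.
Qed.

(** Once psi is gone the differential of the cone modulo the variables is block
    diagonal, with blocks F, 0 and the shifted F. *)
Lemma cone_boundary_rank i j : tor_part F i j *m cst (psi i) = 0 ->
  \rank (tor_boundaries G i j.+1) =
  (\rank (tor_boundaries F i j.+1) + prev_boundary_rank F i j)%N.
Proof.
move=> psi0; rewrite /tor_boundaries cone_tor_part cone_tor_diff.
rewrite !mulmx_block !(mul0mx, mulmx0, add0r, addr0).
rewrite [prev_part i.+1 j *m cst _]psi0 rank_diag_block_mx; congr (_ + _)%N.
rewrite rank_diag_block_mx mxrank0 add0n mulmxN mxrank_opp.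
case: i {psi0} => [|i] /=; last by [].
by rewrite [X in \rank X]thinmx0 mxrank0.
Qed.

(** The internal degree j + 1 of the shifted summands is degree j in K and F.  The
    bound i < j makes psi_i invisible, since K_i lives in degree i. *)
Lemma betti_cone i j : (i < j)%N ->
  tor_part F i.+1 j *m cst (psi i.+1) = 0 ->
  betti G i.+1 j.+1 =
  (betti F i.+1 j.+1 + betti F i j + if i.+1 == j then frrank K i.+1 else 0)%N.
Proof.
move=> lt psi0.
have psi1 : tor_part F i j *m cst (psi i) = 0.
  apply/matrixP => s t; rewrite mul_diag_mx !mxE.
  have [e|_] := eqVneq (frdeg s) j; last by rewrite mul0r.
  rewrite mul1r; apply/eqP; rewrite mcoeff_eq0; apply/negP => /psi_homog.
  by rewrite mdeg0 K_linear; lia.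
have := betti_rankE G i.+1 j.+1; rewrite /= cone_boundary_rank // cone_boundary_rank //.
rewrite cone_tor_part !rank_diag_block_mx [\rank (tor_part K _ _)]linear_tor_part //.
have := betti_rankE F i.+1 j.+1; have := betti_rankE F i j.
by rewrite -[prev_part i.+1 j]/(tor_part F i j) /=; lia.
Qed.

End BettiCone.

(** * Comparison with the Koszul resolution *)

Section LinearComparison.
Variables (k : fieldType) (n : nat) (I J : {mpoly k[n]} -> Prop).
Variables (F : graded_free_resolution I) (K : graded_free_resolution J).
Hypothesis IJ : forall p, I p -> J p.
Hypothesis I_quadratic : forall p m, I p -> (mdeg m <= 1)%N -> p@_m = 0.
Hypothesis K_linear : forall i (s : 'I_(frrank K i)), frdeg s = i.
Hypotheses (K_rank0 : frrank K 0 = 1%N) (K_aug : forall s, fraug K s 0 = 1).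

(** On basis elements of degree i + 2 the coefficients of d(s) are constants, and X
    kills those of lower degree; so d(s) X is a k-linear combination of rows of X,
    to which k-linear lifting applies. *)
Lemma low_degree_row i q (X : 'M[{mpoly k[n]}]_(frrank F i.+1, q)) (s : 'I_(frrank F i.+2)) :
  (forall t, (frdeg t <= i.+1)%N -> row t X = 0) -> (frdeg s <= i.+2)%N ->
  row s (frdiff F i.+1 *m X) =
  constmx n (\row_t (if frdeg t == frdeg s then (frdiff F i.+1 s t)@_0%MM else 0)) *m X.
Proof.
move=> X0 les; rewrite row_mul; apply/rowP => u; rewrite !mxE.
apply: eq_bigr => t _; rewrite !mxE.
have [let1|lt1] := leqP (frdeg t) i.+1.
  by have /rowP/(_ u) := X0 _ let1; rewrite !mxE => ->; rewrite !mulr0.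
congr (_ * _); apply/mpolyP => m; rewrite mcoeffC.
have [m_d|/memN_msupp_eq0 m_d] := boolP (m \in msupp (frdiff F i.+1 s t)).
  have := frdiff_homog m_d => e; have m0 : m = 0%MM.
    by apply/eqP; rewrite -mdeg_eq0; lia.
  have -> : frdeg t == frdeg s by rewrite -e m0 mdeg0.
  by rewrite m0 eqxx mulr1.
rewrite m_d; case: eqP => _; rewrite ?mul0r //.
by case: eqP => [m0|]; rewrite ?mulr0 // -m0 m_d mul0r.
Qed.

(** psi is constructed by k-linear lifting, so by [low_degree_row] and d d = 0 the
    composite psi d vanishes on basis elements of F_(i+1) of degree at most i + 1;
    hence psi_(i+1) vanishes on them, and the others cannot have constant
    coefficients for degree reasons. *)
Lemma linear_comparison :
  exists psi : forall i, 'M[{mpoly k[n]}]_(frrank F i, frrank K i),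
  [/\ degree0_map psi, chain_map psi,
      forall v : 'rV_(frrank F 0),
        (v *m psi 0%N *m fraug K) 0 0 = (v *m fraug F) 0 0 &
      forall i, map_mx (mcoeff 0%MM) (psi i.+1) = 0].
Proof.
pose psi0 : 'M[{mpoly k[n]}]_(frrank F 0, frrank K 0) := fraug F *m const_mx 1.
have aug0 (v : 'rV_(frrank F 0)) : (v *m psi0 *m fraug K) 0 0 = (v *m fraug F) 0 0.
  rewrite -!mulmxA; have -> : (const_mx 1 : 'rV_(frrank K 0)) *m fraug K = 1%:M.
    apply/matrixP => s t; rewrite !ord1 !mxE.
    under eq_bigr do rewrite mxE K_aug mulr1.
    by rewrite sumr_const card_ord K_rank0.
  by rewrite mulmx1.
have [s t m|v Fv|psi [psi_0 hpsi cpsi rel]] := @extend_chain_map _ _ _ _ F K psi0.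
- rewrite mxE big_ord1 mxE mulr1 K_linear addn0; exact: fraug_homog.
- by rewrite /= aug0; apply: IJ.
(* A single basis vector is the simplest k-linear relation. *)
have rel1 i s : row s (frdiff F i *m psi i) = 0 -> row s (psi i.+1) = 0.
  have e q (X : 'M_(_, q)) : row s X = constmx n (delta_mx 0 s) *m X.
    by rewrite rowE /constmx map_delta_mx.
  rewrite !e; apply: (rel _ (frdeg s)) => t ne; rewrite mxE eqxx /=.
  by have [ts|//] := eqVneq t s; rewrite ts eqxx in ne.
have low i s : (frdeg s <= i.+1)%N -> row s (frdiff F i *m psi i) = 0.
  elim: i s => [|i IH] s les.
    rewrite psi_0 mulmxA row_mul; have -> : row s (frdiff F 0 *m fraug F) = 0.
      apply/rowP => t; rewrite !mxE ord1; apply/mpolyP => m; rewrite mcoeff0.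
      set p := \sum_j _.
      have hp : I p.
        have : I ((row s (frdiff F 0) *m fraug F) 0 0).
          by apply/frexact0; exists (delta_mx 0 s); rewrite rowE.
        by rewrite -row_mul !mxE.
      have [le|gt] := leqP (mdeg m) 1; first exact: I_quadratic.
      have hom : homog_entry (frdeg s) 0 p.
        apply: homog_entry_sum => j _; apply: (homog_entryM (b := frdeg j)).
          by move=> m'; apply: frdiff_homog.
        by move=> m'; rewrite addn0; apply: fraug_homog.
      by move/homog_entryP: hom; apply; lia.
    by rewrite mul0mx.
  rewrite low_degree_row //; last by move=> t let1; apply/rel1/IH.
  apply: (rel _ (frdeg s)) => [t /negPf ne|]; first by rewrite mxE ne.
  by rewrite -low_degree_row // mulmxA frdiffK mul0mx row0.
exists psi; split=> // [v|i]; first by rewrite psi_0 aug0.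
apply/matrixP => s t; rewrite !mxE; apply/eqP; rewrite mcoeff_eq0.
apply/negP => m0; have := hpsi _ _ _ _ m0; rewrite mdeg0 add0n K_linear => e.
have /rel1/rowP/(_ t) : row s (frdiff F i *m psi i) = 0 by apply: low; rewrite -e.
by rewrite !mxE => e0; move: m0; rewrite e0 msupp0.
Qed.

End LinearComparison.

(** * The ideals of the cycle and of the wheel *)

Section Ideals.
Variable k : fieldType.

Section Generated.
Variables (n : nat) (s : seq {mpoly k[n]}).

Lemma ideal_genP (P : {mpoly k[n]} -> Prop) :
  P 0 -> (forall p q, P p -> P q -> P (p + q)) ->
  (forall c g, g \in s -> P (c * g)) -> forall p, ideal_gen s p -> P p.
Proof.
move=> P0 PD PM p [c ->]; apply: (big_ind P) => // a _.
by apply/PM/mem_nth.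
Qed.

Lemma ideal_gen_ideal : is_ideal (ideal_gen s).
Proof.
split.
- by exists (fun=> 0); rewrite big1 // => a _; rewrite mul0r.
- move=> p q [c ->] [d ->]; exists (fun a => c a + d a).
  by rewrite -big_split; apply: eq_bigr => a _; rewrite mulrDl.
move=> e p [c ->]; exists (fun a => e * c a).
by rewrite mulr_sumr; apply: eq_bigr => a _; rewrite mulrA.
Qed.

Lemma mem_ideal_gen g : g \in s -> ideal_gen s g.
Proof.
move=> gs; have lt : (index g s < size s)%N by rewrite index_mem.
exists (fun a => (a == Ordinal lt)%:R).
rewrite (bigD1 (Ordinal lt)) //= eqxx mul1r nth_index // big1 ?addr0 // => a.
by move=> /negPf ->; rewrite mul0r.
Qed.

(** A multiple c g of a generator g of degree d has homogeneous parts c' g, where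
    c' runs over the homogeneous parts of c. *)
Lemma ideal_gen_hpart d : (forall g, g \in s -> homog_entry d 0 g) ->
  forall a b p, ideal_gen s p -> ideal_gen s (hpart a b p).
Proof.
move=> hs a b; have [h0 hD hM] := ideal_gen_ideal; apply: ideal_genP.
- by rewrite raddf0.
- by move=> p q hp hq; rewrite raddfD /=; apply: hD.
move=> c g gs; rewrite (@hpartM _ _ a (b + d) b); last first.
  by move=> m /(hs _ gs); rewrite addn0 => <-; rewrite addnC.
exact/hM/mem_ideal_gen.
Qed.

End Generated.

Lemma homog_XX n (i j : 'I_n) : homog_entry 2 0 ('X_i * 'X_j : {mpoly k[n]}).
Proof.
apply: (homog_entryM (b := 1)) => m; rewrite msuppX inE => /eqP ->;
  by rewrite mdeg1.
Qed.

Lemma quadratic_low n (c g : {mpoly k[n]}) m :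
  homog_entry 2 0 g -> (mdeg m <= 1)%N -> (c * g)@_m = 0.
Proof.
move=> hg le; rewrite mcoeffM big1 // => -[m1 m2] /= /eqP e.
have [/hg|/memN_msupp_eq0 ->] := boolP (bmnm m2 \in msupp g); last by rewrite mulr0.
by have := congr1 mdeg e; rewrite mdegD => ? ?; lia.
Qed.

Variable n : nat.

Lemma cycle_ideal_low p m : @cycle_ideal k n p -> (mdeg m <= 1)%N -> p@_m = 0.
Proof.
move=> hp le; move: p hp; apply: ideal_genP.
- by rewrite mcoeff0.
- by move=> p q hp hq; rewrite mcoeffD hp hq addr0.
by move=> c g /mapP[i _ ->]; apply: quadratic_low le; apply: homog_XX.
Qed.

Lemma wheel_ideal_hpart a b p :
  @wheel_ideal k n p -> wheel_ideal (hpart a b p).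
Proof.
apply: (@ideal_gen_hpart _ _ 2) => g; rewrite mem_cat.
by move=> /orP[] /mapP[i _ ->]; apply: homog_XX.
Qed.

Lemma irrelevant_ind (P : {mpoly k[n]} -> Prop) :
  P 0 -> (forall p q, P p -> P q -> P (p + q)) ->
  (forall c i, P (c * 'X_i)) -> forall p, irrelevant p -> P p.
Proof.
move=> P0 PD PX p p0; rewrite (mpolyE p); apply: (big_ind P) => // m _.
have [->|m0] := eqVneq m 0%MM; first by rewrite p0 scale0r.
have [i mi] : exists i, (m i != 0)%N.
  apply/existsP; apply: contraR m0; rewrite negb_exists => /forallP h.
  by apply/eqP/mnmP => i; rewrite mnm0E; apply/eqP; have := h i; rewrite negbK.
have -> : m = (m - U_(i) + U_(i))%MM.
  by apply/mnmP => j; rewrite mnmDE mnmBE mnm1E; case: eqP => [<-|] /=; lia.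
by rewrite mpolyXD scalerAl.
Qed.

Local Notation A := {mpoly k[n.+1]}.

(** For the converse, p = p_0 + x_0 p_+ with p_0 in the cycle ideal, and x_0 p_+ is a
    combination of the x_0 x_i because the coefficients of p_+ lie in
    (x_1, ..., x_n). *)
Lemma wheel_idealE (p : A) : wheel_ideal p <->
  cycle_ideal (x0_coef 0 p) /\ forall e, irrelevant (x0_coef e.+1 p).
Proof.
have [c0 cD cM] : is_ideal (@cycle_ideal k n) := @ideal_gen_ideal _ _.
have [i0 iD iM] := @irrelevant_ideal k n.
have [w0 wD wM] : is_ideal (@wheel_ideal k n) := @ideal_gen_ideal _ _.
split=> [|[h0 hS]].
  move: p; apply: ideal_genP.
  - by split=> [|e]; rewrite raddf0.
  - by move=> p q [p0 pS] [q0 qS]; split=> [|e]; rewrite raddfD /=;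
       [exact: cD|exact: iD (pS e) (qS e)].
  move=> c g; rewrite mem_cat => /orP[] /mapP[i _ ->].
    rewrite -!shift_varsX -rmorphM; split=> [|e]; rewrite x0_coef_mul_shift.
      by apply/cM/mem_ideal_gen/map_f; rewrite mem_enum.
    apply: iM; rewrite /irrelevant rmorphM /= mcoeffX -mdeg_eq0 mdeg1; exact: mul0r.
  rewrite mulrCA -shift_varsX; split=> [|e]; rewrite x0_coef_x0M // x0_coef_mul_shift.
  by apply: iM; rewrite /irrelevant mcoeffX -mdeg_eq0 mdeg1.
have wshift (q : {mpoly k[n]}) : cycle_ideal q -> wheel_ideal (shift_vars q).
  move: q; apply: ideal_genP.
  - by rewrite rmorph0; exact: w0.
  - by move=> q q' hq hq'; rewrite rmorphD /=; exact: wD.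
  move=> c g /mapP[i _ ->]; rewrite !rmorphM /= !shift_varsX; apply/wM/mem_ideal_gen.
  by rewrite mem_cat; apply/orP; left; apply/map_f; rewrite mem_enum.
have wx0 (q : {mpoly k[n]}) : irrelevant q -> wheel_ideal ('X_ord0 * shift_vars q : A).
  move: q; apply: irrelevant_ind.
  - by rewrite rmorph0 mulr0; exact: w0.
  - by move=> q q' hq hq'; rewrite rmorphD /= mulrDr; exact: wD.
  move=> c i; rewrite rmorphM /= shift_varsX mulrCA; apply/wM/mem_ideal_gen.
  by rewrite mem_cat; apply/orP; right; apply/map_f; rewrite mem_enum.
rewrite [p]x0_split; apply: (wD); first exact: wshift.
have : forall v : 'M[A]_1, (forall e, irrelevant (x0_coef e (v 0 0))) ->
    wheel_ideal ('X_ord0 * v 0 0).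
  move=> v; elim/x0_ind: v => [|v IH] hv; first by rewrite mxE mulr0; exact: w0.
  rewrite [v 0 0]x0_split mulrDr; apply: (wD); first exact: wx0.
  by apply: wM; move: IH; rewrite mxE; apply=> e; rewrite x0_coef_quo.
move/(_ (const_mx (x0_quo p))); rewrite mxE; apply=> e.
by rewrite x0_coef_quo.
Qed.

End Ideals.

Local Close Scope ring_scope.

Theorem theorem5p1 (k : fieldType) (n : nat) (hn : 3 <= n)
    (FW : graded_free_resolution (@wheel_ideal k n))
    (FC : graded_free_resolution (@cycle_ideal k n))
    (i : nat) (hi : 1 <= i) :
  (forall j : nat, i.+1 < j ->
     betti FW i j = betti FC i j + betti FC i.-1 j.-1) /\
  betti FW i i.+1 = betti FC i i.+1 + betti FC i.-1 i + 'C(n, i).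
Proof.
have [K [rkK degK augK]] := koszul k n.
have CI (p : {mpoly k[n]}) : cycle_ideal p -> irrelevant p.
  by move=> hp; apply: (cycle_ideal_low hp); rewrite mdeg0.
have [psi [hpsi cpsi apsi mpsi]] := linear_comparison FC CI (@cycle_ideal_low k n)
  degK (etrans (rkK 0) (bin0 n)) augK.
have apsi' (v : 'rV_(frrank FC 0)) :
    irrelevant ((v *m fraug FC) 0 0 - (v *m psi 0 *m fraug K) 0 0)%R.
  by rewrite apsi subrr /irrelevant mcoeff0.
pose G := cone (ideal_gen_ideal _) (@irrelevant_ideal k n) CI (@wheel_idealE k n)
               hpsi cpsi apsi'.
have bettiG j : i <= j -> betti FW i j.+1 =
    betti FC i j.+1 + betti FC i.-1 j + if i == j then 'C(n, i) else 0.
  rewrite (betti_invariant (ideal_gen_ideal _) (@wheel_ideal_hpart k n) FW G).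
  case: i hi => // i' _ lt; rewrite betti_cone ?rkK //.
  by rewrite mpsi mulmx0.
split=> [[|j] // lt|]; last by rewrite bettiG // eqxx.
by rewrite bettiG /=; [case: eqP; lia | lia].
Qed.
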